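(* Let $k$ be an integer with $0\le k\le p-1$ ($p$ the relevant odd prime) and let $l,e$ be integers with $0<l\le e$. Then $D_{3^l,k}(1,x)$ is a permutation polynomial of $\mathbb{F}_{3^e}$ if and only if $k\neq 0$ and $\gcd\big(\frac{3^l-1}{2},\,3^e-1\big)=1$. Moreover, if $p>3$ is prime, then $D_{p^l,k}(1,x)$ is not a permutation polynomial of $\mathbb{F}_{p^e}$.
   Context: For a prime $p$, $q=p^e$, an integer $k$ with $0\le k\le p-1$, and an integer $n\ge1$, $D_{n,k}(1,x)=\sum_{i=0}^{\lfloor n/2\rfloor}\frac{n-ki}{n-i}\binom{n-i}{i}(-x)^i\in\mathbb{F}_q[x]$ (the coefficients are integers, reduced mod $p$). A permutation polynomial of $\mathbb{F}_q$ is a polynomial inducing a bijection of $\mathbb{F}_q$. *)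

(* Defs.v *)
From mathcomp Require Import all_boot all_order all_algebra.

Set Implicit Arguments.
Unset Strict Implicit.
Unset Printing Implicit Defensive.

Import GRing.Theory Num.Theory.
Local Open Scope ring_scope.

(* The integer (n - k i) / (n - i) * 'C(n - i, i). The division is exact for  *)
(* i <= n./2 (see rdickson_coef_rat); n - k i may be negative.                *)
Definition rdickson_coef (n k i : nat) : int :=
  (((n%:Z - k%:Z * i%:Z) * 'C(n - i, i)%:Z) %/ (n%:Z - i%:Z))%Z.

Lemma rdickson_coef_exact (n k i : nat) : (i <= n./2)%N ->
  (n%:Z - i%:Z %| (n%:Z - k%:Z * i%:Z) * 'C(n - i, i)%:Z)%Z.
Proof.
move=> le_in.
have lein : (i <= n)%N by rewrite (leq_trans le_in) // leq_half_double -addnn -addnS leq_addr.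
have -> : n%:Z - k%:Z * i%:Z = (n%:Z - i%:Z) + (1 - k%:Z) * i%:Z.
  by rewrite mulrBl mul1r addrA subrK.
rewrite mulrDl -mulrA; apply: rpredD; first exact: dvdz_mulr.
apply: dvdz_mull; rewrite subzn //; case: i {le_in lein} => [|i].
  by rewrite mul0r dvdz0.
rewrite -PoszM -mul_bin_diag PoszM; exact: dvdz_mulr.
Qed.

Lemma rdickson_coef_rat (n k i : nat) : (0 < n)%N -> (i <= n./2)%N ->
  (rdickson_coef n k i)%:~R
    = (n%:R - k%:R * i%:R) / (n%:R - i%:R) * 'C(n - i, i)%:R :> rat.
Proof.
move=> n_gt0 le_in.
have lt_in : (i < n)%N.
  by rewrite (leq_ltn_trans le_in) // ltn_half_double -addnn -ltn_subLR ?subnn.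
have nz : (n%:R - i%:R : rat) != 0 by rewrite subr_eq0 eqr_nat gtn_eqF.
apply: (mulIf nz); rewrite mulrAC divfK //.
have /divzK/(congr1 (fun z : int => z%:~R : rat)) := rdickson_coef_exact k le_in.
by rewrite -/(rdickson_coef n k i) !(intrM, intrB).
Qed.

(* The reversed Dickson polynomial D_{n,k}(1,x) of the (k+1)-th kind.         *)
Definition rdickson (R : nzRingType) (n k : nat) : {poly R} :=
  \sum_(0 <= i < n./2.+1) (rdickson_coef n k i)%:~R *: (- 'X) ^+ i.

Definition permutation_poly (F : finFieldType) (f : {poly F}) : Prop :=
  bijective (fun x : F => f.[x]).

(* Main.v *)
(** Let [E_n = \sum_i 'C(n - i, i) (-X)^i] be the reversed Dickson polynomial of
    the second kind ([rdickson2]), so that [E_{n+2} = E_{n+1} - X E_n] and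
    [D_{n+2,k} = E_{n+2} - (1 - k) X E_n].  Substituting [X (1 - X)] for [X]
    gives the Binet formula [(2 X - 1) E_n = X^{n+1} - (1 - X)^{n+1}].  When
    [n = p^l] the Frobenius map collapses it and yields
    [2 D_{n,k} = k (1 - 4 X)^((n-1)/2) + 2 - k].  For odd [p] this permutes the
    field iff [k] is nonzero in it and [w |-> w^((n-1)/2)] is a permutation,
    i.e. [(n - 1)/2] is prime to [q - 1].  If [p > 3], then [(p - 1)/2 > 1]
    divides both. *)

Require Import Defs.
From mathcomp Require Import all_boot all_order all_algebra.
From mathcomp Require Import finfield ring.

Set Implicit Arguments.
Unset Strict Implicit.
Unset Printing Implicit Defensive.

Import GRing.Theory.

(** * Reversed Dickson polynomials of the second kind, and Binet's formula *)

Section SecondKind.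

Local Open Scope ring_scope.

(** Summing up to [n] adds only zero terms beyond [n./2] and keeps the recurrence free of parity
    cases. *)
Definition rdickson2 (R : nzRingType) (n : nat) : {poly R} :=
  \sum_(i < n.+1) (- 'X) ^+ i *+ 'C(n - i, i).

Lemma rdickson2_rec (R : nzRingType) n :
  rdickson2 R n.+2 = rdickson2 R n.+1 - 'X * rdickson2 R n.
Proof.
rewrite /rdickson2 big_ord_recl [in RHS]big_ord_recl -addrA; congr (_ + _).
(* The summand of index n+2 is 'C(0, n+2) = 0; the others follow from Pascal's rule. *)
rewrite big_ord_recr /= /bump /= !add1n subnn bin0n mulr0n addr0.
rewrite -mulNr mulr_sumr -big_split /=; apply: eq_bigr => i _.
have lein : (i <= n)%N by rewrite -ltnS ltn_ord.
by rewrite /bump add1n !subSS subSn // binS mulrnDr exprS mulrnAr.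
Qed.

Lemma half_leq_id n : (n./2 <= n)%N.
Proof. by rewrite leq_half_double -addnn -addnS leq_addr. Qed.

Lemma rdickson2_half (R : nzRingType) n :
  rdickson2 R n = \sum_(i < n./2.+1) (- 'X) ^+ i *+ 'C(n - i, i).
Proof.
have le_half : (n./2.+1 <= n.+1)%N by rewrite ltnS half_leq_id.
rewrite (big_ord_widen _ (fun i => (- 'X) ^+ i *+ 'C(n - i, i)) le_half).
rewrite big_mkcond; apply: eq_bigr => i _; case: ifPn => //.
rewrite -leqNgt => lt_n_i; rewrite bin_small ?mulr0n //.
by rewrite ltn_subLR ?addnn -?ltn_half_double // -ltnS ltn_ord.
Qed.

Lemma rdickson_coef0 n k : rdickson_coef n.+1 k 0 = 1.
Proof. by rewrite /rdickson_coef mulr0 !subr0 bin0 mulr1 divzz. Qed.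

(** The numerator splits as (n+2) - k(i+1) = (n+1-i) + (1-k)(i+1), and (i+1) 'C(n+1-i, i+1) =
    (n+1-i) 'C(n-i, i), so the divisor n+1-i cancels from both parts. *)
Lemma rdickson_coefS n k i : (i <= n./2)%N ->
  rdickson_coef n.+2 k i.+1
    = 'C(n.+1 - i, i.+1)%:Z + (1 - k%:Z) * 'C(n - i, i)%:Z.
Proof.
move=> le_in.
have lein : (i <= n)%N by rewrite (leq_trans le_in) // half_leq_id.
rewrite /rdickson_coef subSS.
have -> : n.+2%:Z - i.+1%:Z = (n.+1 - i)%N%:Z by rewrite subzn // ltnS leqW.
have -> : n.+2%:Z - k%:Z * i.+1%:Z
    = (n.+1 - i)%N%:Z + (1 - k%:Z) * i.+1%:Z.
  rewrite -subzn ?leqW // !intS; ring.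
have -> : ((n.+1 - i)%N%:Z + (1 - k%:Z) * i.+1%:Z) * 'C(n.+1 - i, i.+1)%:Z
    = ('C(n.+1 - i, i.+1)%:Z + (1 - k%:Z) * 'C(n - i, i)%:Z) * (n.+1 - i)%N%:Z.
  have /(congr1 Posz) := mul_bin_diag (n.+1 - i) i.
  rewrite subSn //= !PoszM => E.
  by rewrite mulrDl -[_ * i.+1%:Z * _]mulrA -E; ring.
by rewrite mulzK // subSn.
Qed.

Lemma rdicksonSS (R : nzRingType) n k :
  rdickson R n.+2 k
    = rdickson2 R n.+2 - (1 - k%:R) *: ('X * rdickson2 R n).
Proof.
rewrite /rdickson big_mkord (rdickson2_half R n.+2) (rdickson2_half R n) /=.
rewrite big_ord_recl [X in _ = X - _]big_ord_recl rdickson_coef0 bin0.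
rewrite scale1r -!addrA; congr (_ + _).
rewrite -scalerN -mulNr mulr_sumr scaler_sumr -big_split /=.
apply: eq_bigr => i _; rewrite /bump add1n rdickson_coefS -1?ltnS ?ltn_ord //.
rewrite intrD intrM intrB -!pmulrn scalerDl -scalerA !scaler_nat subSS.
by rewrite mulrnAr -exprS.
Qed.

(** X and 1 - X are the roots of T^2 - T + X(1 - X), so their powers obey the substituted recurrence
    of [rdickson2]. *)
Lemma rdickson2_binet (R : comNzRingType) n :
  (rdickson2 R n \Po ('X * (1 - 'X))) * ('X *+ 2 - 1)
    = 'X ^+ n.+1 - (1 - 'X) ^+ n.+1.
Proof.
elim/ltn_ind: n => -[|[|n]] IH.
- rewrite /rdickson2 big_ord1 bin0 expr0 mulr1n comp_polyC mul1r; ring.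
- rewrite /rdickson2 !big_ord_recl big_ord0 /bump /= bin0 expr0 addr0.
  rewrite mulr0n addr0 mulr1n comp_polyC; ring.
rewrite rdickson2_rec comp_polyB comp_polyM comp_polyX mulrBl -mulrA.
rewrite !IH ?ltnS // !exprS; ring.
Qed.

End SecondKind.

(** * Closed forms when n is a power of the characteristic *)

Section PrimePower.

Local Open Scope ring_scope.

(** Composing with a nonconstant polynomial over a domain kills only 0. Identities may thus be
    checked after the substitution, where Binet's formula applies. *)
Lemma comp_poly_XM1BX_inj (R : idomainType) :
  injective (fun f : {poly R} => f \Po ('X * (1 - 'X))).
Proof.
move=> f g /eqP; rewrite -subr_eq0 -comp_polyB comp_poly_eq0 ?subr_eq0.
  by move/eqP.
have sz : size (1 - 'X : {poly R}) = 2 by rewrite -opprB size_polyN size_XsubC.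
by rewrite size_mul ?size_polyX ?sz // -?size_poly_gt0 ?sz ?size_polyX.
Qed.

Lemma pcharn_poly (F : fieldType) n :
  [pchar F].-nat n -> [pchar {poly F}].-nat n.
Proof. by rewrite (eq_pnat n (@pchar_poly F)). Qed.

Lemma XM2B1_neq0 (F : fieldType) : 'X *+ 2 - 1 != 0 :> {poly F}.
Proof.
apply/eqP => /(congr1 (fun f : {poly F} => f.[0])) /eqP.
by rewrite hornerD hornerMn hornerX hornerN !hornerC mul0rn sub0r
  oppr_eq0 oner_eq0.
Qed.

(** Since 1 - 4X(1 - X) = (2X - 1)^2, the right side becomes 1 + (2X - 1)^(n-1). After
    multiplication by 2X - 1, Frobenius turns both sides into 2X^n + 2X - 2. *)
Lemma rdickson2_pchar (F : fieldType) n :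
  [pchar F].-nat n -> odd n ->
  rdickson2 F n *+ 2 = 1 + (1 - 'X *+ 4) ^+ n./2.
Proof.
move=> /pcharn_poly pcharn oddn.
apply: comp_poly_XM1BX_inj => /=; apply: (mulIf (XM2B1_neq0 F)).
have -> : (1 + (1 - 'X *+ 4) ^+ n./2) \Po ('X * (1 - 'X))
    = 1 + ('X *+ 2 - 1) ^+ n.-1 :> {poly F}.
  rewrite comp_polyD comp_polyC rmorphXn /= comp_polyB comp_polyC raddfMn /=.
  rewrite comp_polyX.
  have -> : n.-1 = (2 * n./2)%N.
    by rewrite -[n in LHS]odd_double_half oddn mul2n.
  by rewrite exprM; congr (_ + _ ^+ _); ring.
have n_gt0 : (0 < n)%N by case: n oddn {pcharn}.
rewrite mulrDl -exprSr prednK // raddfMn /= mulrnAl rdickson2_binet.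
rewrite !exprSr !exprDn_pchar // !exprNn_pchar // expr1n.
ring.
Qed.

(** The left side is D_{n+2,0}; substitution turns it into X^(n+2) + (1 - X)^(n+2), which is 1 by
    Frobenius. *)
Lemma rdickson2_lucas_pchar (F : fieldType) n :
  [pchar F].-nat n.+2 -> rdickson2 F n.+2 - 'X * rdickson2 F n = 1.
Proof.
move=> /pcharn_poly pcharn.
apply: comp_poly_XM1BX_inj => /=; apply: (mulIf (XM2B1_neq0 F)).
rewrite comp_polyB comp_polyM comp_polyX comp_polyC mulrBl -mulrA.
rewrite !rdickson2_binet mul1r.
have Frob : (1 - 'X : {poly F}) ^+ n.+2 = 1 - 'X ^+ n.+2.
  by rewrite exprDn_pchar // exprNn_pchar // expr1n.
have -> : (1 - 'X) ^+ n.+3 = (1 - 'X) * (1 - 'X ^+ n.+2) :> {poly F}.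
  by rewrite -Frob exprS.
have -> : 'X * (1 - 'X) * ('X ^+ n.+1 - (1 - 'X) ^+ n.+1)
    = (1 - 'X) * 'X ^+ n.+2 - 'X * (1 - 'X ^+ n.+2) :> {poly F}.
  rewrite -Frob !exprS; ring.
rewrite !exprS; ring.
Qed.

Lemma rdickson_pchar (F : fieldType) n k :
  [pchar F].-nat n -> odd n -> (1 < n)%N ->
  rdickson F n k *+ 2 = k%:R *: (1 - 'X *+ 4) ^+ n./2 + (2 - k%:R)%:P.
Proof.
case: n => [|[|n]] // pcharn oddn _.
(* This writes D_{n+2,k} as k E_{n+2} + (1 - k) D_{n+2,0}, whose two parts have closed forms. *)
have -> : rdickson F n.+2 k = k%:R *: rdickson2 F n.+2
    + (1 - k%:R) *: (rdickson2 F n.+2 - 'X * rdickson2 F n).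
  by rewrite rdicksonSS scalerBr addrA -scalerDl subrKC scale1r.
rewrite rdickson2_lucas_pchar // mulrnDl scalerMnr rdickson2_pchar //.
rewrite -!mul_polyC !(polyCB, polyC1, polyC_natr); ring.
Qed.

End PrimePower.

(** * Power maps on finite fields and the permutation criterion *)

Section PowerMap.

Local Open Scope ring_scope.

Lemma expr_inj_coprime (F : finFieldType) m : (0 < m)%N ->
  injective (fun x : F => x ^+ m) <-> coprime m #|F|.-1.
Proof.
move=> m_gt0; have q1_gt0 : (0 < #|F|.-1)%N.
  by rewrite -subn1 subn_gt0 finNzRing_gt1.
have expf_q1 (x : F) : x != 0 -> x ^+ #|F|.-1 = 1.
  move=> x_neq0; apply: (mulfI x_neq0).
  by rewrite -exprS prednK ?expf_card ?mulr1 // ltnW ?finNzRing_gt1.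
split=> [inj_m | co_m].
  set d := gcdn m #|F|.-1; have d_gt0 : (0 < d)%N by rewrite gcdn_gt0 m_gt0.
  have d_dvd_m : (d %| m)%N by exact: dvdn_gcdl.
  have d_dvd_q : (d %| #|F|.-1)%N by exact: dvdn_gcdr.
  have r_gt0 : (0 < #|F|.-1 %/ d)%N by rewrite divn_gt0 // dvdn_leq.
  (* With r = (q-1)/d, (x^r)^m = (x^(q-1))^(m/d) = 1 = 1^m. All q-1 nonzero elements are then roots
     of X^r - 1, so q-1 <= r and d = 1. *)
  have root_r (x : F) : x != 0 -> x ^+ (#|F|.-1 %/ d) = 1.
    move=> x_neq0; apply: inj_m; rewrite /= expr1n -exprM.
    rewrite -[X in _ ^+ (_ * X)](divnK d_dvd_m) mulnCA divnK // mulnC.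
    by rewrite exprM expf_q1 ?expr1n.
  have : (#|F|.-1 <= #|F|.-1 %/ d)%N.
    rewrite -[in X in (X <= _)%N](cardC1 (0 : F)) cardE.
    apply: max_unity_roots (enum_uniq _) => //; apply/allP => x.
    by rewrite mem_enum inE => /root_r x_r; apply/unity_rootP.
  rewrite leq_divRL // -[X in (_ <= X)%N]muln1 leq_pmul2l //.
  by rewrite /coprime eqn_leq => ->.
move=> x y /= eq_xy.
have [x0 | x_neq0] := eqVneq x 0.
  move/eqP: eq_xy; rewrite x0 expr0n gtn_eqF // eq_sym expf_eq0 m_gt0.
  by move/eqP->.
have y_neq0 : y != 0.
  apply: contra_neq x_neq0 => y0; move/eqP: eq_xy.
  by rewrite y0 expr0n gtn_eqF // expf_eq0 m_gt0 => /eqP.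
(* Here b m = 1 + a (q-1), so raising to the power b undoes the m-th power on nonzero elements. *)
have [a _ /dvdnP[b]] := Bezoutl #|F|.-1 m_gt0; rewrite (eqP co_m) => Db.
have powK (z : F) : z != 0 -> z ^+ m ^+ b = z.
  move=> z_neq0; rewrite -exprM mulnC -Db add1n exprS mulnC exprM.
  by rewrite expf_q1 // expr1n mulr1.
by rewrite -(powK x) // eq_xy powK.
Qed.

Lemma inj_affine_expr (F : fieldType) (a b c d : F) m : a != 0 -> c != 0 ->
  injective (fun x : F => a * (c * x + d) ^+ m + b)
    <-> injective (fun x : F => x ^+ m).
Proof.
move=> a_neq0 c_neq0; split=> inj x y /= eq_xy; last first.
  apply: (mulfI c_neq0); apply: (addIr d); apply: inj => /=.
  exact/(mulfI a_neq0)/(addIr b).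
have affK z : c * ((z - d) / c) + d = z by rewrite mulrC divfK ?subrK.
apply: (addIr (- d)); apply: (mulIf (invr_neq0 c_neq0)); apply: inj => /=.
by rewrite !affK eq_xy.
Qed.

Lemma permutation_polyP (F : finFieldType) (f : {poly F}) :
  permutation_poly f <-> injective (horner f).
Proof. by split=> [/bij_inj | /injF_bij]. Qed.

Lemma permutation_rdickson_prime_power (F : finFieldType) p l e k :
  prime p -> odd p -> (0 < l)%N -> #|F| = (p ^ e)%N ->
  permutation_poly (rdickson F (p ^ l) k)
    <-> ~~ (p %| k)%N /\ coprime ((p ^ l).-1)./2 #|F|.-1.
Proof.
move=> pr_p odd_p l_gt0 cardF; set n := (p ^ l)%N; set m := (n.-1)./2.
have pF : p \in [pchar F] := card_finPcharP cardF pr_p.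
have pn : [pchar F].-nat n.
  by rewrite (eq_pnat _ (pcharf_eq pF)) pnatX pnat_id.
have odd_n : odd n by rewrite oddX odd_p orbT.
have n_gt2 : (2 < n)%N.
  apply: leq_trans (odd_prime_gt2 odd_p pr_p) _.
  by rewrite -[X in (X <= _)%N]expn1; apply: leq_pexp2l (prime_gt0 pr_p) l_gt0.
have m_half : m = n./2.
  by rewrite /m; case: (n) odd_n => //= r; rewrite uphalf_half => /negPf->.
have m_gt0 : (0 < m)%N by rewrite m_half half_gt0 ltnW.
have two_neq0 : 2 != 0 :> F.
  by rewrite -(dvdn_pcharf pF) gtnNdvd ?odd_prime_gt2.
have four_neq0 : - 4 != 0 :> F by rewrite oppr_eq0 (natrM _ 2 2) mulf_neq0.
have hornerRD x : (rdickson F n k).[x] * 2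
    = k%:R * (- 4 * x + 1) ^+ m + (2 - k%:R).
  rewrite mulr_natr -hornerMn rdickson_pchar ?(ltnW n_gt2) // -m_half.
  rewrite hornerD hornerZ horner_exp hornerC; congr (_ * _ ^+ _ + _).
  rewrite hornerD hornerN hornerMn hornerX hornerC; ring.
have injD : injective (horner (rdickson F n k))
    <-> injective (fun x : F => k%:R * (- 4 * x + 1) ^+ m + (2 - k%:R)).
  split=> inj x y eq_xy; apply: inj; last by rewrite /= -!hornerRD eq_xy.
  by apply: (mulIf two_neq0); rewrite !hornerRD.
rewrite permutation_polyP injD (dvdn_pcharf pF).
(* If k vanishes in the field the map is constant and identifies 0 with 1; otherwise it is a power
   map between affine bijections. *)
have [k0 | k_neq0] := eqVneq (k%:R : F) 0.
  split=> [inj | [//]]; suff /eqP : 0 = 1 :> F by rewrite eq_sym oner_eq0.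
  by apply: inj; rewrite k0 !mul0r.
by rewrite (inj_affine_expr _ _ _ k_neq0) // expr_inj_coprime //; split=> [|[]].
Qed.

End PowerMap.

Theorem theorem2p8 (k l e : nat) (hl : 0 < l) (hle : l <= e) :
  (forall F : finFieldType, k <= 3 - 1 -> #|F| = 3 ^ e ->
     (permutation_poly (rdickson F (3 ^ l) k) <->
      k <> 0 /\ gcdn ((3 ^ l - 1) %/ 2) (3 ^ e - 1) = 1))
  /\
  (forall (p : nat) (F : finFieldType), prime p -> 3 < p -> k <= p - 1 ->
     #|F| = p ^ e ->
     ~ permutation_poly (rdickson F (p ^ l) k)).
Proof.
split=> [F lek cardF | p F pr_p p_gt3 _ cardF].
  rewrite (permutation_rdickson_prime_power k _ _ hl cardF) // cardF.
  rewrite !subn1 divn2 /coprime.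
  have -> : (3 %| k) = (k == 0) by case: k lek => [|[|[|]]].
  by split=> [[/eqP ? /eqP] | [/eqP ? /eqP]].
have odd_p : odd p by case/even_prime: pr_p p_gt3 => // ->.
case/(permutation_rdickson_prime_power k pr_p odd_p hl cardF) => _.
(* The even number p - 1 divides p^i - 1. Halving both for i = l, and using i = e > 0, makes (p-1)/2
   a common divisor, which is at least 2 because p >= 5. *)
have dvd_half i : 0 < i -> ((p.-1)./2.*2 %| (p ^ i).-1).
  case: i => // i _; rewrite even_halfK; last by case: (p) odd_p.
  by rewrite predn_exp dvdn_mulr.
have dvd_m : (p.-1)./2 %| ((p ^ l).-1)./2.
  have /dvdnP[c ->] := dvd_half l hl.
  by rewrite -doubleMr doubleK dvdn_mull.
have dvd_q : (p.-1)./2 %| #|F|.-1.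
  rewrite cardF (dvdn_trans _ (dvd_half e (leq_trans hl hle))) //.
  by rewrite -muln2 dvdn_mulr.
have /gtnNdvd/negP half_ndvd1 : 1 < (p.-1)./2.
  by case: (p) p_gt3 odd_p => [|[|[|[|[|]]]]].
by move=> /eqP co; apply: half_ndvd1; rewrite // -co dvdn_gcd dvd_m.
Qed.
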